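(* Let $R$ be a semi-local ring with nilpotent Jacobson radical and let $M$ be a right $R$-module. Then $M$ is hereditarily Bassian if and only if the socle $\mathrm{Soc}(M)$ is finitely generated.
   Context: Rings are associative with identity and modules are unital right modules. A module $M$ is Bassian if, for every submodule $N$ of $M$, the existence of a monomorphism $M\to M/N$ forces $N=0$. A module $M$ is hereditarily Bassian if every submodule of $M$ is Bassian. A ring $R$ with Jacobson radical $J$ is semi-local if $R/J$ is semi-simple Artinian. $\mathrm{Soc}(M)$ is the sum of all simple submodules of $M$. *)

(* Defs.v *)
From HB Require Import structures.
From mathcomp Require Import all_boot all_algebra.
From mathcomp Require Import generic_quotient ring_quotient boolp.

Set Implicit Arguments.
Unset Strict Implicit.
Unset Printing Implicit Defensive.

Import GRing.Theory.
Local Open Scope ring_scope.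
Local Open Scope quotient_scope.

(* Modules are left modules [V : lmodType A] over a possibly zero ring [A].
   A right R-module is an [lmodType R^c], where [R^c] is the opposite ring; in
   particular [R^c^o] is R as a right module over itself ([a *: x] is [x * a]
   computed in R), so a right ideal of R is a [submodClosed R^c^o].
   Submodules are boolean predicates; this is no restriction, because [boolp]
   makes every [Prop]-valued predicate boolean. *)

Section Submodules.
Variables (A : pzRingType) (V : lmodType A) (N : submodClosed V).

Fact submod_zmod_closed : zmod_closed (N : {pred V}).
Proof. exact: GRing.submod_closedB (submodClosedP N). Qed.

Definition submod_zmod : zmodClosed V :=
  HB.pack (N : {pred V})
    (GRing.isZmodClosed.Build V (N : {pred V}) submod_zmod_closed).

Definition submod_of := {x : V | x \in N}.

HB.instance Definition _ := SubChoice.on submod_of.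
HB.instance Definition _ := [SubChoice_isSubLmodule of submod_of by <:].

Definition quot_mod := Quotient.quot submod_zmod.

HB.instance Definition _ := GRing.Zmodule.on quot_mod.
HB.instance Definition _ := EqQuotient.on quot_mod.

Definition quot_scale (a : A) : quot_mod -> quot_mod :=
  lift_op1 quot_mod ( *:%R a).

Lemma pi_quot_add x y :
  \pi_quot_mod (x + y) = \pi_quot_mod x + \pi_quot_mod y.
Proof. exact: Quotient.pi_add. Qed.

Lemma pi_quot_scale a x :
  \pi_quot_mod (a *: x) = quot_scale a (\pi_quot_mod x).
Proof.
rewrite /quot_scale; unlock; apply/eqP.
rewrite -(Quotient.idealrBE submod_zmod) -scalerBr.
apply: (rpredZ (s := N)); rewrite -[_ \in _]/(_ \in submod_zmod).
by rewrite Quotient.idealrBE reprK.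
Qed.

Fact quot_scaleA a b v : quot_scale a (quot_scale b v) = quot_scale (a * b) v.
Proof. by rewrite -[v]reprK -!pi_quot_scale scalerA. Qed.

Fact quot_scale1 : left_id 1 quot_scale.
Proof. by move=> v; rewrite -[v]reprK -pi_quot_scale scale1r. Qed.

Fact quot_scaleDr : right_distributive quot_scale +%R.
Proof.
move=> a u v; rewrite -[u]reprK -[v]reprK.
by rewrite -pi_quot_add -!pi_quot_scale -pi_quot_add scalerDr.
Qed.

Fact quot_scaleDl v : {morph quot_scale^~ v : a b / a + b}.
Proof.
by move=> a b; rewrite -[v]reprK -!pi_quot_scale scalerDl pi_quot_add.
Qed.

HB.instance Definition _ := GRing.Zmodule_isLmodule.Build A quot_mod
  quot_scaleA quot_scale1 quot_scaleDr quot_scaleDl.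

End Submodules.

Section ModuleProperties.
Variables (A : pzRingType) (V : lmodType A).

Definition zero_submod (N : submodClosed V) := forall x, x \in N -> x = 0.

Definition full_submod (N : submodClosed V) := forall x, x \in N.

Definition simple_module :=
  (exists x : V, x <> 0) /\
  (forall N : submodClosed V, zero_submod N \/ full_submod N).

Definition maximal_submod (N : submodClosed V) :=
  ~ full_submod N /\
  (forall P : submodClosed V, {subset N <= P} -> P =i N \/ full_submod P).

Definition finitely_generated :=
  exists n (g : 'I_n -> V),
    forall v, exists a : 'I_n -> A, v = \sum_(i < n) a i *: g i.

Definition artinian :=
  forall N : nat -> submodClosed V,
    (forall n, {subset N n.+1 <= N n}) ->
  exists n, forall m, (n <= m)%N -> N m =i N n.

Definition bassian :=
  forall N : submodClosed V,
    (exists f : {linear V -> quot_mod N}, injective f) -> zero_submod N.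

End ModuleProperties.

Arguments simple_module {A} V.
Arguments finitely_generated {A} V.
Arguments artinian {A} V.
Arguments bassian {A} V.

Definition hereditarily_bassian (A : pzRingType) (V : lmodType A) :=
  forall N : submodClosed V, bassian (submod_of N).

(* The sum of all simple submodules, i.e. the finite sums of elements that lie
   in simple submodules. *)
Section Socle.
Variables (A : pzRingType) (V : lmodType A).

Definition socle : {pred V} := fun x =>
  `[< exists s : seq V,
        (forall y, y \in s ->
           exists S : submodClosed V,
             simple_module (submod_of S) /\ y \in S) /\
        x = \sum_(y <- s) y >].

Fact socle_subsemimod_closed : subsemimod_closed socle.
Proof.
split; first split.
- by apply/asboolP; exists [::]; rewrite big_nil.
- move=> _ _ /asboolP[s [simS ->]] /asboolP[t [simT ->]].
  apply/asboolP; exists (s ++ t); rewrite big_cat; split=> // y.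
  by rewrite mem_cat => /orP[/simS|/simT].
move=> a _ /asboolP[s [simS ->]]; apply/asboolP.
exists [seq a *: y | y <- s]; rewrite big_map scaler_sumr; split=> //.
move=> _ /mapP[y sy ->]; have [S [simpleS yS]] := simS y sy; by exists S; rewrite rpredZ.
Qed.

HB.instance Definition _ :=
  GRing.isSubSemiModClosed.Build A V socle socle_subsemimod_closed.

End Socle.

Arguments socle {A} V.

HB.mixin Record isTwoSided (R : pzRingType) (I : R -> bool) := {
  ideal_mull : forall a x, x \in I -> a * x \in I;
  ideal_mulr : forall a x, x \in I -> x * a \in I
}.

#[short(type="ideal")]
HB.structure Definition Ideal (R : pzRingType) :=
  {I of GRing.ZmodClosed R I & isTwoSided R I}.

Section QuotientRing.
Variables (R : pzRingType) (I : ideal R).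

Definition quot_ring := Quotient.quot I.

HB.instance Definition _ := GRing.Zmodule.on quot_ring.
HB.instance Definition _ := EqQuotient.on quot_ring.

Definition quot_one : quot_ring := \pi_quot_ring 1.
Definition quot_mul : quot_ring -> quot_ring -> quot_ring :=
  lift_op2 quot_ring *%R.

Lemma pi_ring_add x y :
  \pi_quot_ring (x + y) = \pi_quot_ring x + \pi_quot_ring y.
Proof. exact: Quotient.pi_add. Qed.

Lemma pi_ring_mul x y :
  \pi_quot_ring (x * y) = quot_mul (\pi_quot_ring x) (\pi_quot_ring y).
Proof.
rewrite /quot_mul; unlock; apply/eqP; rewrite -Quotient.idealrBE.
rewrite -(subrKA (x * repr (\pi_quot_ring y))) -mulrBr -mulrBl rpredD //.
  by rewrite ideal_mull // Quotient.idealrBE reprK.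
by rewrite ideal_mulr // Quotient.idealrBE reprK.
Qed.

Fact quot_mulA : associative quot_mul.
Proof.
move=> x y z; rewrite -[x]reprK -[y]reprK -[z]reprK.
by rewrite -!pi_ring_mul mulrA.
Qed.

Fact quot_mul1 : left_id quot_one quot_mul.
Proof. by move=> x; rewrite -[x]reprK -pi_ring_mul mul1r. Qed.

Fact quot_mulr1 : right_id quot_one quot_mul.
Proof. by move=> x; rewrite -[x]reprK -pi_ring_mul mulr1. Qed.

Fact quot_mulDl : left_distributive quot_mul +%R.
Proof.
move=> x y z; rewrite -[x]reprK -[y]reprK -[z]reprK.
by rewrite -pi_ring_add -!pi_ring_mul -pi_ring_add mulrDl.
Qed.

Fact quot_mulDr : right_distributive quot_mul +%R.
Proof.
move=> x y z; rewrite -[x]reprK -[y]reprK -[z]reprK.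
by rewrite -pi_ring_add -!pi_ring_mul -pi_ring_add mulrDr.
Qed.

HB.instance Definition _ := GRing.Zmodule_isPzRing.Build quot_ring
  quot_mulA quot_mul1 quot_mulr1 quot_mulDl quot_mulDr.

End QuotientRing.

Section JacobsonRadical.
Variable R : pzRingType.

Definition jacobson : {pred R} := fun x =>
  `[< forall m : submodClosed R^c^o, maximal_submod m -> x \in m >].

Fact jacobson_zmod_closed : zmod_closed jacobson.
Proof.
split; first by apply/asboolP => m _; apply: (rpred0 m).
move=> x y /asboolP Jx /asboolP Jy; apply/asboolP => m max_m.
exact: (submod_zmod_closed m).2 (Jx m max_m) (Jy m max_m).
Qed.

Fact jacobson_mulr a x : x \in jacobson -> x * a \in jacobson.
Proof.
move=> /asboolP Jx; apply/asboolP => m max_m.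
exact: (@GRing.rpredZ R^c R^c^o m a x (Jx m max_m)).
Qed.

Fact residual_closed (r : R) (m : submodClosed R^c^o) :
  subsemimod_closed ([pred y | r * y \in m] : {pred R^c^o}).
Proof.
split; first split; rewrite ?inE.
- by rewrite mulr0; apply: (rpred0 m).
- by move=> x y; rewrite !inE mulrDr; apply: (rpredD (S := m)).
move=> a x; rewrite !inE => rx_m.
by rewrite [r * _]mulrA; apply: (@GRing.rpredZ R^c R^c^o m a (r * x)).
Qed.

Fact add_cyclic_closed (s : R) (m : submodClosed R^c^o) :
  subsemimod_closed
    ((fun y => `[< exists a : R, y - s * a \in m >]) : {pred R^c^o}).
Proof.
split; first split.
- by apply/asboolP; exists 0; rewrite mulr0 subr0; apply: (rpred0 m).
- move=> x y /asboolP[a xa] /asboolP[b yb]; apply/asboolP; exists (a + b).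
  by rewrite mulrDr opprD addrACA; apply: (rpredD (S := m)).
move=> c x /asboolP[a xa]; apply/asboolP; exists (a * c).
rewrite mulrA -[_ - _]/((x : R) * c - s * a * c) -mulrBl.
exact: (@GRing.rpredZ R^c R^c^o m c (x - s * a)).
Qed.

Fact jacobson_mull r x : x \in jacobson -> r * x \in jacobson.
Proof.
move=> /asboolP Jx; apply/asboolP => m [_ max_m].
pose P : submodClosed R^c^o := HB.pack ([pred y | r * y \in m] : {pred R^c^o})
  (GRing.isSubSemiModClosed.Build R^c R^c^o _ (residual_closed r m)).
have [r_m|r_m] := boolP (r \in m).
  exact: (@GRing.rpredZ R^c R^c^o m x r r_m).
suff max_P : maximal_submod P by exact: Jx P max_P.
split=> [/(_ 1)|Q PQ]; first by rewrite inE mulr1 (negPf r_m).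
have [[q]|QP] := pselect (exists q : R, q \in Q /\ r * q \notin m); last first.
  left=> y; apply/idP/idP; last exact: PQ.
  by move=> Qy; apply: contra_notT QP; exists y.
move=> [Qq rq_m]; right.
pose T : submodClosed R^c^o :=
  HB.pack ((fun y => `[< exists a : R, y - (r * q) * a \in m >]) : {pred R^c^o})
  (GRing.isSubSemiModClosed.Build R^c R^c^o _ (add_cyclic_closed (r * q) m)).
have [|Tm|fullT] := max_m T.
- by move=> y ym; apply/asboolP; exists 0; rewrite mulr0 subr0.
- case/negP: rq_m; rewrite -Tm; apply/asboolP; exists 1.
  by rewrite mulr1 subrr; apply: (rpred0 m).
have /asboolP[a ra] := fullT r.
have Q1 : (1 : R) \in Q.
  rewrite -[1 : R](subrK (q * a)); apply: (rpredD (S := Q)).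
    by apply: PQ; rewrite inE mulrBr mulr1 mulrA.
  exact: (@GRing.rpredZ R^c R^c^o Q a q Qq).
move=> y; have := @GRing.rpredZ R^c R^c^o Q y _ Q1.
by rewrite -[_ *: _]/(1 * (y : R)) mul1r.
Qed.

HB.instance Definition _ := GRing.isZmodClosed.Build R jacobson
  jacobson_zmod_closed.
HB.instance Definition _ := isTwoSided.Build R jacobson
  jacobson_mull jacobson_mulr.

(* Additively generated by the products of n elements of I. *)
Definition ideal_pow (I : {pred R}) n (x : R) :=
  exists k (y : 'I_k -> 'I_n -> R),
    (forall i j, y i j \in I) /\ x = \sum_(i < k) \prod_(j < n) y i j.

Definition nilpotent_ideal (I : {pred R}) :=
  exists2 n, (0 < n)%N & forall x, ideal_pow I n x -> x = 0.

Definition semisimple_artinian :=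
  (forall x : R^c^o, x \in socle R^c^o) /\ artinian R^c^o.

End JacobsonRadical.

Arguments jacobson R : clear implicits.

Definition semilocal (R : pzRingType) :=
  semisimple_artinian (quot_ring (jacobson R)).

(* Main.v *)
Require Import Defs.
From HB Require Import structures.
From mathcomp Require Import all_boot all_algebra.
From mathcomp Require Import generic_quotient ring_quotient boolp.

Set Implicit Arguments.
Unset Strict Implicit.
Unset Printing Implicit Defensive.

Import GRing.Theory.
Local Open Scope ring_scope.
Local Open Scope quotient_scope.

(** Write J for the Jacobson radical of R, and x a for the action of R on the
    right; in the code x a is [(a : R^c) *: x]. Both directions rest on the
    fact that Soc(M) is the annihilator of J in M. A simple module is killed by
    J because the annihilator of a nonzero element is a maximal right ideal
    ([socle_radical_killed]). Conversely, semi-simplicity of R/J lets one write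
    1 = y_1 + ... + y_m modulo J, where each y_j generates a simple right ideal
    of R/J ([semilocal_minimal_decomposition]). If x J = 0 then x is the sum of
    the x y_j, and each x y_j is zero or generates a simple module, being the
    image of a simple right ideal of R/J.

    Suppose that M is hereditarily Bassian and Soc(M) is not finitely
    generated. For some j the elements x y_j with x in Soc(M) do not lie in a
    finitely generated submodule of Soc(M). Pick w_0, w_1, ... among them, each
    outside the span of the previous ones. As w_n R is simple, the sum of the
    w_n R is direct; and all w_n have the same annihilator
    { a | y_j a in J }. Hence w_n |-> w_{n+1} defines a shift on the sum T of
    the w_n R, which induces a monomorphism T -> T / w_0 R, so that T is not
    Bassian ([shift_not_bassian], [hereditarily_bassian_socle]).

    Suppose that Soc(M) is finitely generated. It is then a finite sum of simple
    modules, hence noetherian, and so is Soc(V) for each submodule V of M. Let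
    f : V -> V/N be a monomorphism. Then N meets each V J^k trivially, by
    descending induction on k, starting from the exponent with J^n = 0
    ([noetherian_socle_bassian]). Indeed let Q be the set of x in V J^k with
    x J = 0. An element of N in V J^k is multiplied by J into N and V J^{k+1},
    hence into 0, so it lies in Q. For the same reason f maps Q into the image
    of Q in V/N: if f x is the class of z in V J^k, then z J lies in N and in
    V J^{k+1}. So f embeds the noetherian module Q in its quotient by its
    intersection with N, and this intersection is zero
    ([noetherian_in_ker_trivial]). The case k = 0 gives N = 0. *)

(** * Submodules as propositional predicates *)

Section PropSubmodules.
Variables (A : pzRingType) (V : lmodType A).
Implicit Types (P Q : V -> Prop) (x y : V) (s : seq V).

Definition is_submod P :=
  [/\ P 0, forall x y, P x -> P y -> P (x + y) & forall a x, P x -> P (a *: x)].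

Fact asbool_submod_closed P : is_submod P ->
  subsemimod_closed ((fun x => `[< P x >]) : {pred V}).
Proof.
move=> [P0 PD PZ]; split; first split; first exact/asboolP.
  by move=> x y /asboolP Px /asboolP Py; apply/asboolP; apply: PD.
by move=> a x /asboolP Px; apply/asboolP; apply: PZ.
Qed.

Definition submod_of_prop P (subP : is_submod P) : submodClosed V :=
  HB.pack ((fun x => `[< P x >]) : {pred V})
    (GRing.isSubSemiModClosed.Build A V _ (asbool_submod_closed subP)).

Lemma submod_of_propP P (subP : is_submod P) x :
  reflect (P x) (x \in submod_of_prop subP).
Proof. exact: asboolP. Qed.

Lemma is_submod_mem (N : submodClosed V) : is_submod (fun x => x \in N).
Proof.
by split; [exact: rpred0 | exact: rpredD | move=> a x; exact: rpredZ].
Qed.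

Lemma is_submodB P x y : is_submod P -> P x -> P y -> P (x - y).
Proof. by move=> [_ PD PZ] Px Py; rewrite -scaleN1r; apply/PD/PZ. Qed.

Lemma is_submod_sum P I (r : seq I) (F : I -> V) :
  is_submod P -> (forall i, P (F i)) -> P (\sum_(i <- r) F i).
Proof. by move=> [P0 PD _] PF; elim/big_rec: _ => // i x _; apply: PD. Qed.

(** The submodule generated by S, as the intersection of the submodules that
    contain it: an element of [gen S] is used by choosing the submodule P. *)
Definition gen (S : V -> Prop) x :=
  forall P, is_submod P -> (forall y, S y -> P y) -> P x.

Lemma gen_submod S : is_submod (gen S).
Proof.
split=> [P [] //|x y gx gy P subP SP|a x gx P subP SP]; case: (subP) => _ PD PZ.
  by apply: PD; [apply: gx | apply: gy].
by apply: PZ; apply: gx.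
Qed.

Lemma gen_incl (S : V -> Prop) x : S x -> gen S x.
Proof. by move=> Sx P _; apply. Qed.

Lemma gen_mono (S T : V -> Prop) x :
  (forall y, S y -> gen T y) -> gen S x -> gen T x.
Proof. by move=> ST; apply=> //; apply: gen_submod. Qed.

End PropSubmodules.

Lemma simple_cyclic (A : pzRingType) (V : lmodType A) (S : submodClosed V) x y :
  simple_module (submod_of S) -> x \in S -> x <> 0 -> y \in S ->
  exists a, y = a *: x.
Proof.
move=> [_ simS] xS x0 yS.
pose P (u : submod_of S) := exists a, val u = a *: x.
have subP : is_submod P.
  split; first by exists 0; rewrite scale0r.
    by move=> u v [a ua] [b vb]; exists (a + b); rewrite scalerDl -ua -vb.
  by move=> c u [a ua]; exists (c * a); rewrite -scalerA -ua.
have [zP|fP] := simS (submod_of_prop subP); last first.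
  by exact: (elimT (submod_of_propP subP _) (fP (exist _ y yS))).
case: x0; have Px : (exist _ x xS : submod_of S) \in submod_of_prop subP.
  by apply/submod_of_propP; exists 1; rewrite scale1r.
exact: (congr1 val (zP _ Px)).
Qed.

Section QuotientProjection.
Variables (A : pzRingType) (V : lmodType A) (N : submodClosed V).

Fact pi_quot_linear : linear (\pi_(quot_mod N) : V -> quot_mod N).
Proof. by move=> a x y; rewrite pi_quot_add pi_quot_scale. Qed.

Definition quot_proj : {linear V -> quot_mod N} :=
  HB.pack (\pi_(quot_mod N) : V -> quot_mod N)
    (GRing.isLinear.Build _ _ _ _ _ pi_quot_linear).

Lemma quot_proj_eq x y : quot_proj x = quot_proj y -> x - y \in N.
Proof. by move=> /eqP; rewrite -(Quotient.idealrBE (submod_zmod N)). Qed.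

Lemma quot_proj_eq0 x : quot_proj x = 0 <-> x \in N.
Proof.
split=> [|xN]; first by rewrite -(raddf0 quot_proj) => /quot_proj_eq; rewrite subr0.
rewrite -(raddf0 quot_proj); apply/eqP.
by rewrite -(Quotient.idealrBE (submod_zmod N)) subr0.
Qed.

Lemma quot_proj_surj u : exists x, quot_proj x = u.
Proof. by exists (repr u); exact: reprK. Qed.

End QuotientProjection.

(** * Ascending chain condition *)

Section Noetherian.
Variables (A : pzRingType) (V : lmodType A).
Implicit Types (P Q : V -> Prop).

(** The chain condition refers to the submodules inside Q only, so that it
    passes to smaller predicates whether or not these are submodules. *)
Definition noetherian_in Q := forall P : nat -> V -> Prop,
  (forall n, is_submod (P n)) -> (forall n x, P n x -> Q x) ->
  (forall n x, P n x -> P n.+1 x) ->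
  exists n, forall m x, (n <= m)%N -> P m x -> P n x.

Lemma chain_mono (P : nat -> V -> Prop) m n x :
  (forall n x, P n x -> P n.+1 x) -> (m <= n)%N -> P m x -> P n x.
Proof. by move=> incP /subnK <-; elim: (_ - _)%N => // k IH /IH; apply: incP. Qed.

Lemma noetherian_in_sub P Q :
  (forall x, P x -> Q x) -> noetherian_in Q -> noetherian_in P.
Proof.
by move=> PQ noethQ C subC CP incC; apply: noethQ => // n x /CP /PQ.
Qed.

(** The modular law: two nested submodules with the same intersection with Q
    and the same sum with Q are equal, and both data stabilise along a chain. *)
Lemma noetherian_in_add P Q : is_submod P -> is_submod Q ->
  noetherian_in P -> noetherian_in Q ->
  noetherian_in (fun x => exists y z, [/\ P y, Q z & x = y + z]).
Proof.
move=> subP subQ noethP noethQ C subC CPQ incC.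
have [P0 PD PZ] := subP; have [Q0 QD QZ] := subQ.
(* The traces of the chain on Q stabilise from m on, and the projections to P
   along Q from n on. *)
have [||| m stabm] := noethQ (fun n x => C n x /\ Q x).
- move=> n; have [C0 CD CZ] := subC n.
  by split=> [|x y [? ?] [? ?]|a x [? ?]]; split; auto.
- by move=> n x [].
- by move=> n x [/incC].
have [||| n stabn] := noethP (fun n x => P x /\ exists2 z, Q z & C n (x + z)).
- move=> n; have [C0 CD CZ] := subC n; split.
  + by split=> //; exists 0; rewrite ?addr0.
  + move=> x y [Px [z Qz Cz]] [Py [t Qt Ct]]; split; first exact: PD.
    by exists (z + t); [exact: QD | rewrite addrACA; exact: CD].
  + move=> a x [Px [z Qz Cz]]; split; first exact: PZ.
    by exists (a *: z); [exact: QZ | rewrite -scalerDr; exact: CZ].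
- by move=> n x [].
- by move=> n x [Px [z Qz /incC Cz]]; split=> //; exists z.
pose N := maxn m n; have mN : (m <= N)%N by exact: leq_maxl.
have nN : (n <= N)%N by exact: leq_maxr.
exists N => k x Nk Ckx; have [y [z [Py Qz xE]]] := CPQ _ _ Ckx.
have [|_ [t Qt Cyt]] := stabn k y (leq_trans nN Nk).
  by split=> //; exists z; rewrite // -xE.
have CNyt : C N (y + t) by apply: chain_mono Cyt.
have [_ CD _] := subC N.
rewrite -[x](subrK (y + t)); apply: CD => //.
have [|Cm _] := stabm k (x - (y + t)) (leq_trans mN Nk).
  split; first by apply: is_submodB => //; apply: chain_mono CNyt.
  by rewrite xE opprD addrACA subrr add0r; apply: is_submodB.
exact: chain_mono Cm.
Qed.

Lemma noetherian_in_zero : noetherian_in (fun x : V => x = 0).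
Proof.
move=> C subC C0 _; by exists 0%N => m x _ /C0 ->; have [] := subC 0%N.
Qed.

Lemma noetherian_in_simple (S : submodClosed V) :
  simple_module (submod_of S) -> noetherian_in (fun x => x \in S).
Proof.
move=> simS C subC CS incC.
have [[n [x [Cx x0]]]|triv] := pselect (exists n x, C n x /\ x <> 0); last first.
  exists 0%N => m x _ Cx; have [C0 _ _] := subC 0%N.
  have [-> //|x0] := eqVneq x 0.
  by case: triv; exists m, x; split=> //; apply/eqP.
exists n => m y _ Cy; have [a ->] := simple_cyclic simS (CS _ _ Cx) x0 (CS _ _ Cy).
by have [_ _ CZ] := subC n; apply: CZ.
Qed.

Lemma noetherian_in_gen (s : seq V) :
  (forall y, y \in s ->
     exists S : submodClosed V, simple_module (submod_of S) /\ y \in S) ->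
  noetherian_in (gen (fun y => y \in s)).
Proof.
elim: s => [|y s IH] simp_s.
  apply: noetherian_in_sub noetherian_in_zero => x gx.
  apply: (gx (fun z => z = 0)) => //.
  by split=> // [x' y' -> ->|a x' ->]; rewrite ?addr0 ?scaler0.
have [S [simS yS]] := simp_s y (mem_head _ _).
have noeths := IH (fun z zs => simp_s z (mem_behead (s := y :: s) zs)).
have [g0 gD gZ] := gen_submod (fun z => z \in s).
apply: noetherian_in_sub (noetherian_in_add (is_submod_mem S)
  (gen_submod (fun z => z \in s)) (noetherian_in_simple simS) noeths).
move=> x gx.
apply: (gx (fun x => exists u v, [/\ u \in S, gen (fun z => z \in s) v & x = u + v])).
  split; first by exists 0, 0; rewrite rpred0 addr0.
    move=> _ _ [u [v [uS gv ->]]] [u' [v' [uS' gv' ->]]].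
    exists (u + u'), (v + v').
    by split; [exact: rpredD | exact: gD | rewrite addrACA].
  move=> a _ [u [v [uS gv ->]]]; exists (a *: u), (a *: v).
  by split; [exact: rpredZ | exact: gZ | rewrite scalerDr].
move=> z; rewrite inE => /orP[/eqP ->|zs]; first by exists y, 0; rewrite addr0.
by exists 0, z; rewrite rpred0 add0r; split=> //; apply: gen_incl.
Qed.

(** A noetherian module is Bassian, in a form where p plays the projection and
    f maps into p(Q). The chain 0, p^-1(f 0), p^-1(f (p^-1(f 0))), ... inside Q
    stabilises, and its second term contains the kernel of p in Q. *)
Lemma noetherian_in_ker_trivial (W : lmodType A) (f p : {linear V -> W}) Q :
  is_submod Q -> noetherian_in Q -> injective f ->
  (forall x, Q x -> exists2 y, Q y & f x = p y) ->
  forall x, Q x -> p x = 0 -> x = 0.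
Proof.
move=> [Q0 QD QZ] noethQ f_inj f_p.
pose C := fix C n x :=
  if n is k.+1 then Q x /\ exists2 y, C k y & p x = f y else x = 0.
have CQ n x : C n x -> Q x by case: n => [/= -> //|n []].
have incC n x : C n x -> C n.+1 x.
  elim: n x => [|n IH] x; last by move=> [Qx [y /IH Cy ?]]; split=> //; exists y.
  by move=> /= ->; split=> //; exists 0; rewrite // !raddf0.
have subC n : is_submod (C n).
  elim: n => [|n [C0 CD CZ]].
    by split=> //= [x y -> ->|a x ->]; rewrite ?addr0 ?scaler0.
  split=> /=; first by split=> //; exists 0; rewrite // !raddf0.
    move=> x y [Qx [x' Cx px]] [Qy [y' Cy py]]; split; first exact: QD.
    by exists (x' + y'); [exact: CD | rewrite !raddfD /= px py].
  move=> a x [Qx [x' Cx px]]; split; first exact: QZ.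
  by exists (a *: x'); [exact: CZ | rewrite !linearZ_LR px].
have [n stab] := noethQ C subC CQ incC.
have {}stab : forall x, C n.+1 x -> C n x by move=> x; apply: stab.
(* Injectivity of f pushes a repetition in the chain down to its start. *)
elim: n stab => [stab x Qx px|n IH stab].
  by apply: (stab x); split=> //; exists 0; rewrite // px raddf0.
apply: IH => x Cx; have [y Qy fx] := f_p x (CQ _ _ Cx).
have [|_ [x' Cx' py]] := stab y; first by split=> //; exists x.
by rewrite (f_inj x x') // fx.
Qed.

End Noetherian.

Lemma noetherian_in_submod_of (A : pzRingType) (V : lmodType A)
    (N : submodClosed V) (P : V -> Prop) (Q : submod_of N -> Prop) :
  (forall x, Q x -> P (val x)) -> noetherian_in P -> noetherian_in Q.
Proof.
move=> QP noethP C subC CQ incC.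
have [||| n stab] := noethP (fun n x => exists2 y, C n y & val y = x).
- move=> n; have [C0 CD CZ] := subC n; split; first by exists 0.
    by move=> _ _ [x Cx <-] [y Cy <-]; exists (x + y); first exact: CD.
  by move=> a _ [x Cx <-]; exists (a *: x); first exact: CZ.
- by move=> n _ [y /CQ/QP Py <-].
- by move=> n _ [y /incC Cy <-]; exists y.
exists n => m x nm Cx; have [|y Cy /val_inj <- //] := stab m (val x) nm.
by exists x.
Qed.

(** * The shift on an infinite homogeneous direct sum *)

(** In this section the sum of the A w_i is direct and its summands are
    isomorphic by w_i |-> w_j. *)
Section Shift.
Variables (A : pzRingType) (V : lmodType A) (w : nat -> V).
Hypothesis w_indep : forall n (a : nat -> A),
  \sum_(i < n) a i *: w i = 0 -> forall i, (i < n)%N -> a i *: w i = 0.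
Hypothesis w_ann : forall a i j, a *: w i = 0 -> a *: w j = 0.

(** The graph of the shift w_i |-> w_{i+1} on the span of the w_i. A relation
    avoids choosing coefficients: these are not unique, only the products
    with the w_i are. *)
Definition shift_rel x y :=
  exists n (a : nat -> A),
    x = \sum_(i < n) a i *: w i /\ y = \sum_(i < n) a i *: w i.+1.

Lemma comb_pad (u : nat -> V) m n (a : nat -> A) : (n <= m)%N ->
  \sum_(i < n) a i *: u i = \sum_(i < m) (if (i < n)%N then a i else 0) *: u i.
Proof.
move=> nm; rewrite (big_ord_widen m (fun i => a i *: u i) nm) big_mkcond /=.
by apply: eq_bigr => i _; case: ifP => // _; rewrite scale0r.
Qed.

Lemma shift_relD x y x' y' :
  shift_rel x y -> shift_rel x' y' -> shift_rel (x + x') (y + y').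
Proof.
move=> [n [a [-> ->]]] [m [b [-> ->]]].
exists (maxn n m), (fun i => (if (i < n)%N then a i else 0) +
                             (if (i < m)%N then b i else 0)).
have [nM mM] := (leq_maxl n m, leq_maxr n m).
rewrite (comb_pad w a nM) (comb_pad w b mM).
rewrite (comb_pad (w \o succn) a nM) (comb_pad (w \o succn) b mM).
by rewrite -!big_split; split; apply: eq_bigr => i _; rewrite scalerDl.
Qed.

Lemma shift_relZ c x y : shift_rel x y -> shift_rel (c *: x) (c *: y).
Proof.
move=> [n [a [-> ->]]]; exists n, (fun i => c * a i); rewrite !scaler_sumr.
by split; apply: eq_bigr => i _; rewrite scalerA.
Qed.

Lemma shift_rel0 y : shift_rel 0 y -> y = 0.
Proof.
move=> [n [a [/esym/w_indep a0 ->]]]; rewrite big1 // => i _.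
by apply: w_ann (a0 _ (ltn_ord i)).
Qed.

Lemma shift_rel_fun x y z : shift_rel x y -> shift_rel x z -> y = z.
Proof.
move=> xy /(shift_relZ (-1)) xz; apply/eqP; rewrite -subr_eq0 -scaleN1r.
by apply/eqP/shift_rel0; have := shift_relD xy xz; rewrite (scaleN1r x) subrr.
Qed.

(** If the shift of x is b w_0, then moving b w_0 to the other side gives a
    vanishing combination of the w_i, so each of its terms vanishes. *)
Lemma shift_rel_kernel x y b : shift_rel x y -> y = b *: w 0%N -> x = 0.
Proof.
move=> [n [a [-> ->]]] yE; rewrite big1 // => i _.
pose c i := if i is k.+1 then a k else - b.
have /w_indep c0 : \sum_(j < n.+1) c j *: w j = 0.
  by rewrite big_ord_recl /= scaleNr yE addNr.
exact: w_ann (c0 i.+1 (ltn_ord i)).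
Qed.

Lemma shift_dom_submod : is_submod (fun x => exists y, shift_rel x y).
Proof.
split; first by exists 0, 0%N, (fun=> 0); rewrite !big_ord0.
  by move=> x x' [y xy] [y' xy']; exists (y + y'); apply: shift_relD.
by move=> c x [y xy]; exists (c *: y); apply: shift_relZ.
Qed.

Lemma shift_dom_codom x y : shift_rel x y -> exists z, shift_rel y z.
Proof.
move=> [n [a [_ ->]]].
pose c i := if i is k.+1 then a k else 0.
exists (\sum_(i < n.+1) c i *: w i.+1), n.+1, c; split=> //.
by rewrite big_ord_recl /= scale0r add0r.
Qed.

(** The shift composed with the projection modulo A w_0 is a monomorphism from
    the span of the w_i to its quotient by A w_0. *)
Lemma shift_not_bassian : hereditarily_bassian V -> w 0%N = 0.
Proof.
pose T := submod_of_prop shift_dom_submod; move=> /(_ T) bassT.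
pose N0 (t : submod_of T) := exists b, val t = b *: w 0%N.
have subN : is_submod N0.
  split; first by exists 0; rewrite scale0r.
    by move=> u v [a ua] [b vb]; exists (a + b); rewrite scalerDl -ua -vb.
  by move=> c u [a ua]; exists (c * a); rewrite -scalerA -ua.
pose N := submod_of_prop subN.
have /choice[f f_rel] (t : submod_of T) :
    exists t' : submod_of T, shift_rel (val t) (val t').
  have /submod_of_propP[y ty] := valP t.
  have yT : y \in T by apply/submod_of_propP/(shift_dom_codom ty).
  by exists (exist _ y yT).
have f_lin : linear f.
  move=> c u v; apply: val_inj; apply: shift_rel_fun (f_rel _) _.
  exact: shift_relD (shift_relZ c (f_rel u)) (f_rel v).
pose F : {linear submod_of T -> submod_of T} :=
  HB.pack f (GRing.isLinear.Build _ _ _ _ _ f_lin).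
pose g : {linear submod_of T -> quot_mod N} := quot_proj N \o F.
have w0T : w 0%N \in T.
  apply/submod_of_propP; exists (w 1%N), 1%N, (fun=> 1).
  by rewrite !big_ord1 !scale1r.
suff g_inj : injective g.
  have zN := bassT N (ex_intro _ g g_inj).
  have w0N : (exist _ (w 0%N) w0T : submod_of T) \in N.
    by apply/(submod_of_propP subN); exists 1; rewrite scale1r.
  exact: (congr1 val (zN _ w0N)).
move=> u v /quot_proj_eq/(submod_of_propP subN)[b fb].
apply/eqP; rewrite -subr_eq0; apply/eqP/val_inj.
apply: (shift_rel_kernel (y := val (f u) - val (f v)) (b := b)) => //.
by rewrite -!scaleN1r; exact: shift_relD (f_rel u) (shift_relZ _ (f_rel v)).
Qed.

End Shift.

(** * Finite generation *)

Lemma finitely_generated_gen (A : pzRingType) (V : lmodType A)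
    (N : submodClosed V) :
  finitely_generated (submod_of N) <->
  exists s : seq V, (forall z, z \in s -> z \in N) /\
    (forall x, x \in N -> gen (fun z => z \in s) x).
Proof.
split=> [[n [g g_gen]]|[s [sN s_gen]]].
  exists [seq val (g i) | i <- enum 'I_n]; split=> [_ /mapP[i _ ->]|x xN].
    exact: valP.
  have [a xE] := g_gen (exist _ x xN).
  have -> : x = \sum_(i < n) a i *: val (g i).
    rewrite -[LHS]/(val (exist _ x xN : submod_of N)) xE.
    by rewrite raddf_sum; apply: eq_bigr.
  apply: is_submod_sum (gen_submod _) _ => i.
  have [_ _ gZ] := gen_submod (fun z => z \in [seq val (g i) | i <- enum 'I_n]).
  by apply: gZ; apply: gen_incl; apply: map_f; rewrite mem_enum.
have s_nth (i : 'I_(size s)) : nth 0 s i \in N by apply/sN/mem_nth.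
exists (size s), (fun i : 'I_(size s) => exist _ (nth 0 s i) (s_nth i)) => v.
pose P u := exists a : 'I_(size s) -> A, u = \sum_(i < size s) a i *: nth 0 s i.
suff [a vE] : P (val v) by exists a; apply: val_inj; rewrite vE raddf_sum.
apply: (s_gen _ (valP v) P) => [|z zs].
  split; first by exists (fun=> 0); rewrite big1 // => i _; rewrite scale0r.
    move=> _ _ [a ->] [b ->]; exists (fun i => a i + b i).
    by rewrite -big_split; apply: eq_bigr => i _; rewrite scalerDl.
  move=> c _ [a ->]; exists (fun i => c * a i).
  by rewrite scaler_sumr; apply: eq_bigr => i _; rewrite scalerA.
have iz : (index z s < size s)%N by rewrite index_mem.
exists (fun i => (i == Ordinal iz)%:R); rewrite (bigD1 (Ordinal iz)) //= eqxx.
rewrite scale1r nth_index // big1 ?addr0 // => i /negPf ->.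
by rewrite scale0r.
Qed.

(** * The socle over a semilocal ring *)

Section Radical.
Variables (R : pzRingType) (V : lmodType R^c).
Local Notation J := (jacobson R).
Implicit Types (x : V) (a b y : R).

(** Over [R^c] scalars compose in the reverse order. This keeps the products
    in R, where membership in the radical is stated. *)
Lemma right_scaleA a b x :
  (b : R^c) *: ((a : R^c) *: x) = ((a * b : R) : R^c) *: x.
Proof. by rewrite scalerA. Qed.

Definition radical_killed x := forall a, a \in J -> (a : R^c) *: x = 0.

Lemma radical_killed_submod : is_submod radical_killed.
Proof.
split=> [a _|x y Jx Jy a Ja|b x Jx a Ja]; first by rewrite scaler0.
  by rewrite scalerDr Jx // Jy // addr0.
by rewrite right_scaleA Jx // ideal_mull.
Qed.

(** For nonzero x in a simple module, the annihilator of x is a maximal right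
    ideal: for q outside it, x q generates the simple module, so x = x q b for
    some b, and 1 = (1 - q b) + q b lies in any right ideal that contains q and
    the annihilator. *)
Lemma simple_radical_killed (S : submodClosed V) x :
  simple_module (submod_of S) -> x \in S -> radical_killed x.
Proof.
move=> simS xS a /asboolP Ja.
have [->|/eqP x0] := eqVneq x 0; first by rewrite scaler0.
pose P (b : R^c^o) := (b : R^c) *: x = 0.
have subP : is_submod P.
  split; first exact: scale0r.
    by move=> b c; rewrite /P scalerDl => -> ->; rewrite addr0.
  by move=> c b Pb; rewrite /P -scalerA Pb scaler0.
suff maxP : maximal_submod (submod_of_prop subP).
  exact: (elimT (submod_of_propP subP _) (Ja _ maxP)).
split=> [/(_ 1)/(submod_of_propP subP)|Q PQ]; first by rewrite /P scale1r.
have [[q [Qq qx]]|QP] := pselect (exists q : R^c^o, q \in Q /\ ~ P q).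
  right=> r; have [_ _ SZ] := is_submod_mem S.
  have [b xE] := simple_cyclic simS (SZ (q : R^c) _ xS) qx xS.
  have Q1 : (1 : R^c^o) \in Q.
    have [_ QD QZ] := is_submod_mem Q.
    rewrite -[1 : R^c^o](subrK ((b : R^c) *: q)); apply: QD; last exact: QZ.
    apply/PQ/(submod_of_propP subP).
    by rewrite /P scalerBl scale1r -scalerA -xE subrr.
  have [_ _ QZ] := is_submod_mem Q.
  by rewrite -[r](mulr1 (r : R^c)); exact: (QZ (r : R^c)).
left=> q; apply/idP/idP => [Qq|]; last exact: PQ.
by apply/(submod_of_propP subP); apply: contrapT => Pq; apply: QP; exists q.
Qed.

Lemma socle_radical_killed x : x \in socle V -> radical_killed x.
Proof.
move=> /asboolP[s [sim_s ->]]; have [J0 JD _] := radical_killed_submod.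
rewrite big_seq; elim/big_rec: _ => [|y z ys]; [exact: J0 | apply: JD].
by have [S [simS yS]] := sim_s y ys; exact: simple_radical_killed yS.
Qed.

(** The image of y in R/J is zero or generates a simple right ideal: each
    nonzero multiple y a of y generates y again. *)
Definition minimal_mod_radical y :=
  forall a, y * a \in J \/ exists b, y * a * b - y \in J.

Variable y : R.
Hypothesis min_y : minimal_mod_radical y.

(** The cyclic module generated by x y is an image of the right ideal generated
    by y in R/J, so a nonzero multiple of x y generates it. *)
Lemma minimal_return x a : radical_killed x ->
  (a : R^c) *: ((y : R^c) *: x) <> 0 ->
  exists b : R, (b : R^c) *: ((a : R^c) *: ((y : R^c) *: x)) = (y : R^c) *: x.
Proof.
move=> Jx; rewrite right_scaleA; case: (min_y a) => [/Jx -> //|[b Jb] _].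
exists b; rewrite right_scaleA; apply/eqP; rewrite -subr_eq0 -scalerBl.
by apply/eqP/Jx.
Qed.

(** The annihilator of a nonzero x y depends on y only, so all such elements
    generate isomorphic modules. *)
Lemma minimal_annihilator x a : radical_killed x -> (y : R^c) *: x <> 0 ->
  (a : R^c) *: ((y : R^c) *: x) = 0 <-> y * a \in J.
Proof.
move=> Jx yx0; rewrite right_scaleA; split=> [yax|/Jx //].
case: (min_y a) => // -[b /Jx]; rewrite scalerBl -right_scaleA yax scaler0.
by rewrite sub0r => /eqP; rewrite oppr_eq0 => /eqP.
Qed.

End Radical.

Lemma minimal_simple (R : pzRingType) (V : lmodType R^c) (y : R) (x : V) :
  minimal_mod_radical y -> radical_killed x -> (y : R^c) *: x <> 0 ->
  exists S : submodClosed V,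
    simple_module (submod_of S) /\ (y : R^c) *: x \in S.
Proof.
move=> min_y Jx yx0; set z := _ *: x in yx0 *.
pose P (t : V) := exists a : R, t = (a : R^c) *: z.
have subP : is_submod P.
  split; first by exists 0; rewrite scale0r.
    by move=> _ _ [a ->] [b ->]; exists (a + b); rewrite scalerDl.
  by move=> c _ [a ->]; exists (a * c); rewrite right_scaleA.
pose S := submod_of_prop subP.
have zS : z \in S by apply/submod_of_propP; exists 1; rewrite scale1r.
exists S; split=> //; split.
  by exists (exist _ z zS) => /(congr1 val).
move=> N; have [[t [tN t0]]|zN] := pselect (exists t, t \in N /\ t <> 0); last first.
  by left=> t tN; apply: contrapT => t0; apply: zN; exists t.
right=> u; have /(submod_of_propP subP)[a tE] := valP t.
have [|b bt] := minimal_return min_y (a := a) Jx.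
  by rewrite -/z -tE => t00; apply: t0; apply: val_inj.
have /(submod_of_propP subP)[c uE] := valP u.
have -> : u = (c : R^c) *: ((b : R^c) *: t).
  by apply: val_inj; rewrite uE /= tE bt.
by have [_ _ NZ] := is_submod_mem N; do 2!apply: (NZ).
Qed.

(** Since 1 lies in the socle of R/J, it is a finite sum of elements of simple
    right ideals of R/J; the y are representatives of these elements. *)
Lemma semilocal_minimal_decomposition (R : pzRingType) : semilocal R ->
  exists ys : seq R, 1 - \sum_(y <- ys) y \in jacobson R /\
    forall y, y \in ys -> minimal_mod_radical y.
Proof.
set Q := quot_ring (jacobson R).
case=> /(_ 1)/asboolP[s [sim_s sE]] _.
pose p (a : R) : Q := \pi_Q a.
have p_eq a b : (a - b \in jacobson R) = (p a == p b).
  by rewrite Quotient.idealrBE.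
have pD a b : p (a + b) = p a + p b by exact: pi_ring_add.
have p0 : p 0 = 0 by apply: (addrI (p 0)); rewrite -pD !addr0.
have pM a b : p (a * b) = p a * p b by exact: pi_ring_mul.
have pr (u : Q) : p (repr u) = u by exact: reprK.
exists [seq repr (y : Q) | y <- s]; split.
  rewrite p_eq big_map; apply/eqP.
  have -> : p 1 = \sum_(y <- s) (y : Q) by exact: sE.
  by rewrite (big_morph p pD p0); apply: eq_bigr => y _; rewrite pr.
move=> _ /mapP[y ys ->] a; have [S [simS yS]] := sim_s y ys.
have [|/negP ya0] := boolP (repr (y : Q) * a \in jacobson R); [by left | right].
pose z : Q^c^o := p (repr (y : Q) * a).
have zE : z = (p a : Q^c) *: (y : Q^c^o) by rewrite /z pM pr.
have zS : z \in S by rewrite zE; have [_ _ SZ] := is_submod_mem S; apply: SZ.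
have z0 : z <> 0.
  move=> z0; apply: ya0; rewrite -[_ * a]subr0 p_eq p0; apply/eqP; exact: z0.
have [b yE] := simple_cyclic simS zS z0 yS.
exists (repr (b : Q)); rewrite p_eq pM !pr; apply/eqP/esym; exact: yE.
Qed.

(** Otherwise one can choose w_0, w_1, ..., each of the form x y and outside the
    span of its predecessors. Then the sum of the modules w_n R is direct,
    because w_n is recovered from each of its nonzero multiples, and the w_n
    have the same annihilator. *)
Lemma hereditarily_bassian_homogeneous (R : pzRingType) (V : lmodType R^c)
    (y : R) :
  hereditarily_bassian V -> minimal_mod_radical y ->
  exists s : seq V, (forall z, z \in s -> radical_killed z) /\
    forall x, radical_killed x -> gen (fun z => z \in s) ((y : R^c) *: x).
Proof.
move=> bassV min_y; apply: contrapT => nofg.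
have [J0 JD JZ] := radical_killed_submod V.
have /choice[F F_new] (s : seq V) : exists x : V,
    (forall z, z \in s -> radical_killed z) ->
    radical_killed x /\ ~ gen (fun z => z \in s) ((y : R^c) *: x).
  have [Js|] := pselect (forall z, z \in s -> radical_killed z); last by exists 0.
  apply: contrapT => nox; apply: nofg; exists s; split=> // x Jx.
  by apply: contrapT => ngx; apply: nox; exists x.
pose L := fix L n := if n is k.+1 then (y : R^c) *: F (L k) :: L k else [::].
have JL n z : z \in L n -> radical_killed z.
  elim: n z => // n IH z /=; rewrite inE => /orP[/eqP ->|]; last exact: IH.
  by apply: JZ; have [] := F_new _ IH.
pose x n := F (L n); pose w n := (y : R^c) *: x n.
have Jx n : radical_killed (x n) by have [] := F_new _ (@JL n).
have w_new n : ~ gen (fun z => z \in L n) (w n) by have [] := F_new _ (@JL n).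
have wL n i : (i < n)%N -> w i \in L n.
  elim: n => // n IH; rewrite ltnS leq_eqVlt inE => /orP[/eqP ->|/IH ->].
    by rewrite eqxx.
  by rewrite orbT.
have w0 n : w n <> 0.
  move=> wn0; apply: (w_new n); rewrite wn0.
  by have [] := gen_submod (fun z => z \in L n).
apply: (w0 0%N); apply: shift_not_bassian bassV => [n a|a i j].
  elim: n => // n IH; rewrite big_ord_recr /= => sum0.
  have an0 : a n *: w n = 0.
    apply: contrapT => /(minimal_return min_y (Jx n))[b bw].
    have gL := gen_submod (fun z => z \in L n); have [_ _ gZ] := gL.
    apply: (w_new n); rewrite /w -bw; apply: (gZ); rewrite -/(w n).
    move: sum0 => /eqP; rewrite addrC addr_eq0 => /eqP ->.
    rewrite -scaleN1r; apply: (gZ).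
    apply: is_submod_sum gL _ => i.
    by apply: (gZ); apply: gen_incl; apply: wL (ltn_ord i).
  move: sum0; rewrite an0 addr0 => /IH an i.
  by rewrite ltnS leq_eqVlt => /orP[/eqP ->|/an].
by move=> /(minimal_annihilator min_y _ (Jx i) (w0 i))
          /(minimal_annihilator min_y _ (Jx j) (w0 j)).
Qed.

Section SemilocalSocle.
Variables (R : pzRingType) (V : lmodType R^c) (ys : seq R).
Hypothesis sum_ys : 1 - \sum_(y <- ys) y \in jacobson R.
Hypothesis min_ys : forall y, y \in ys -> minimal_mod_radical y.

Lemma radical_killed_sum (x : V) : radical_killed x ->
  x = \sum_(y <- ys) (y : R^c) *: x.
Proof.
move=> /(_ _ sum_ys); rewrite -scaler_suml scalerBl scale1r => /eqP.
by rewrite subr_eq0 => /eqP.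
Qed.

Lemma radical_killed_socle (x : V) : radical_killed x -> x \in socle V.
Proof.
move=> Jx; rewrite (radical_killed_sum Jx) big_seq; apply: rpred_sum => y yys.
have [->|/eqP yx0] := eqVneq ((y : R^c) *: x) 0; first exact: rpred0.
have [S [simS xS]] := minimal_simple (min_ys yys) Jx yx0.
apply/asboolP; exists [:: (y : R^c) *: x]; rewrite big_seq1; split=> // z.
by rewrite inE => /eqP ->; exists S.
Qed.

Lemma hereditarily_bassian_socle :
  hereditarily_bassian V -> finitely_generated (submod_of (socle V)).
Proof.
move=> bassV; apply/finitely_generated_gen.
suff [s [Js s_gen]] : exists s : seq V, (forall z, z \in s -> radical_killed z) /\
    forall x, radical_killed x ->
      forall y, y \in ys -> gen (fun z => z \in s) ((y : R^c) *: x).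
  exists s; split=> [z /Js|x /socle_radical_killed Jx].
    exact: radical_killed_socle.
  rewrite (radical_killed_sum Jx) big_seq; have [g0 gD _] := gen_submod (fun z => z \in s).
  by elim/big_rec: _ => [|y z yys gz]; [exact: g0 | apply: gD gz; exact: s_gen].
elim: ys min_ys => [_|y r IH min_r]; first by exists [::].
have [t [Jt t_gen]] := IH (fun z zr => min_r z (mem_behead (s := y :: r) zr)).
have [s [Js s_gen]] := hereditarily_bassian_homogeneous bassV (min_r y (mem_head _ _)).
exists (s ++ t); split=> [z|x Jx z]; first by rewrite mem_cat => /orP[/Js|/Jt].
rewrite inE => /orP[/eqP ->|zr].
  apply: gen_mono (s_gen _ Jx) => u us.
  by apply: gen_incl; rewrite mem_cat us.
apply: gen_mono (t_gen _ Jx _ zr) => u ut.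
by apply: gen_incl; rewrite mem_cat ut orbT.
Qed.

Lemma noetherian_in_radical_killed :
  finitely_generated (submod_of (socle V)) -> noetherian_in (@radical_killed R V).
Proof.
move=> /finitely_generated_gen[s [s_soc s_gen]].
suff [t [sim_t t_gen]] : exists t : seq V,
    (forall y, y \in t ->
      exists S : submodClosed V, simple_module (submod_of S) /\ y \in S) /\
    forall x, x \in s -> gen (fun y => y \in t) x.
  apply: noetherian_in_sub (noetherian_in_gen sim_t) => x.
  by move=> /radical_killed_socle /s_gen; exact: gen_mono.
elim: s s_soc {s_gen} => [_|x s IH x_soc]; first by exists [::].
have [t [sim_t t_gen]] := IH (fun z zs => x_soc z (mem_behead (s := x :: s) zs)).
have /asboolP[u [sim_u xE]] := x_soc x (mem_head _ _).
exists (u ++ t); split=> [y|y].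
  by rewrite mem_cat => /orP[/sim_u|/sim_t].
rewrite inE => /orP[/eqP ->|/t_gen]; last first.
  by apply: gen_mono => z zt; apply: gen_incl; rewrite mem_cat zt orbT.
have [g0 gD _] := gen_submod (fun z => z \in u ++ t).
rewrite xE big_seq; elim/big_rec: _ => [|z v zu]; [exact: g0 | apply: gD].
by apply: gen_incl; rewrite mem_cat zu.
Qed.

End SemilocalSocle.

(** * The radical filtration *)

Section RadicalFiltration.
Variable R : pzRingType.
Local Notation J := (jacobson R).

(** The submodule V J^n. The constructors describe the additive group generated
    by the products x a with x in V J^n and a in J. *)
Inductive radical_power (V : lmodType R^c) : nat -> V -> Prop :=
| RadicalPower0 x : radical_power 0 x
| RadicalPower_zero n : radical_power n 0
| RadicalPower_add n x y :
    radical_power n x -> radical_power n y -> radical_power n (x + y)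
| RadicalPower_act n x (a : R) :
    radical_power n x -> a \in J -> radical_power n.+1 ((a : R^c) *: x).

Lemma radical_power_submod (V : lmodType R^c) n :
  is_submod (@radical_power V n).
Proof.
split; [exact: RadicalPower_zero | exact: RadicalPower_add |].
move=> b x; elim=> {n x} [x|n|n x y _ IHx _ IHy|n x a Xx _ Ja].
- exact: RadicalPower0.
- by rewrite scaler0; exact: RadicalPower_zero.
- by rewrite scalerDr; exact: RadicalPower_add.
by rewrite right_scaleA; apply: RadicalPower_act => //; exact: ideal_mulr.
Qed.

Lemma radical_power_map (V W : lmodType R^c) (f : {linear V -> W}) n x :
  radical_power n x -> radical_power n (f x).
Proof.
elim=> {n x} [x|n|n x y _ IHx _ IHy|n x a _ IH Ja].
- exact: RadicalPower0.
- by rewrite raddf0; exact: RadicalPower_zero.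
- by rewrite raddfD; exact: RadicalPower_add.
by rewrite linearZ_LR; exact: RadicalPower_act.
Qed.

Lemma radical_power_lift (V : lmodType R^c) (N : submodClosed V) n
    (u : quot_mod N) :
  radical_power n u -> exists2 x, radical_power n x & quot_proj N x = u.
Proof.
elim=> {n u} [u|n|n u v _ [x Xx <-] _ [y Xy <-]|n u a _ [x Xx <-] Ja].
- by have [x <-] := quot_proj_surj u; exists x; first exact: RadicalPower0.
- by exists 0; [exact: RadicalPower_zero | rewrite raddf0].
- by exists (x + y); [exact: RadicalPower_add | rewrite raddfD].
by exists ((a : R^c) *: x); [exact: RadicalPower_act | rewrite linearZ_LR].
Qed.

(** A product of n elements of J is one of the generators of J^n, hence zero. An
    element of V J^k is killed by products of the remaining n - k factors. *)
Lemma radical_power_nilpotent (V : lmodType R^c) :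
  nilpotent_ideal J -> exists n, forall x : V, radical_power n x -> x = 0.
Proof.
move=> [n _ nilJ].
have prodJ (s : seq R) : size s = n -> (forall a, a \in s -> a \in J) ->
    \prod_(a <- s) a = 0.
  move=> sn sJ; apply: nilJ; exists 1%N, (fun _ (j : 'I_n) => nth 0 s j).
  split=> [_ j|]; first by apply: sJ; rewrite mem_nth // sn.
  by rewrite big_ord1 (big_nth 0) sn big_mkord.
suff kill k x : @radical_power V k x -> forall s : seq R, (k + size s)%N = n ->
    (forall a, a \in s -> a \in J) -> ((\prod_(a <- s) a : R) : R^c) *: x = 0.
  exists n => x /kill/(_ [::]); rewrite big_nil addn0 scale1r.
  by move=> /(_ erefl) ->.
elim=> {k x} [x|k|k x y _ IHx _ IHy|k x a _ IH Ja] s sn sJ.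
- by rewrite prodJ // scale0r.
- by rewrite scaler0.
- by rewrite scalerDr IHx // IHy // addr0.
rewrite right_scaleA; have := IH (a :: s); rewrite big_cons; apply.
  by rewrite /= addnS.
by move=> b; rewrite inE => /orP[/eqP ->|/sJ].
Qed.

(** Descending induction along the radical filtration: N meets V J^(n - k)
    trivially for every k up to n. *)
Lemma noetherian_socle_bassian (V : lmodType R^c) :
  nilpotent_ideal J -> noetherian_in (@radical_killed R V) -> bassian V.
Proof.
move=> /(radical_power_nilpotent V)[n X0] noethV N [f f_inj].
suff NX k : (k <= n)%N -> forall x, radical_power (n - k) x -> x \in N -> x = 0.
  by move=> x; apply: (NX n) => //; rewrite subnn; exact: RadicalPower0.
elim: k => [_ x|k IH kn]; first by rewrite subn0 => /X0.
have {IH}NX (y : V) : radical_power (n - k.+1).+1 y -> y \in N -> y = 0.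
  by rewrite -subSn // subSS; apply: IH; exact: ltnW.
have [J0 JD JZ] := radical_killed_submod V.
have [XS0 XD XZ] := radical_power_submod V (n - k.+1).
pose Q (y : V) := radical_power (n - k.+1) y /\ radical_killed y.
move=> x Xx xN.
apply: (noetherian_in_ker_trivial (f := f) (p := quot_proj N) (Q := Q)) => //.
- by split=> [|y z [? ?] [? ?]|a y [? ?]]; split; auto.
- by apply: noetherian_in_sub noethV => y [].
- move=> y [Xy Jy]; have [z Xz zE] := radical_power_lift (radical_power_map f Xy).
  exists z => //; split=> // a Ja; apply: NX; first exact: RadicalPower_act.
  by apply/quot_proj_eq0; rewrite linearZ_LR zE -linearZ_LR Jy // raddf0.
- split=> // a Ja; apply: NX; first exact: RadicalPower_act.
  by have [_ _ NZ] := is_submod_mem N; exact: NZ.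
exact/quot_proj_eq0.
Qed.

End RadicalFiltration.

(** * Modules with finitely generated socle *)

Theorem theorem2p6 (R : pzRingType) (M : lmodType R^c) :
  semilocal R -> nilpotent_ideal (jacobson R) ->
  hereditarily_bassian M <-> finitely_generated (submod_of (socle M)).
Proof.
move=> /semilocal_minimal_decomposition[ys [sum_ys min_ys]] nilJ; split.
  exact: hereditarily_bassian_socle sum_ys min_ys.
move=> /(noetherian_in_radical_killed sum_ys min_ys) noethM N.
apply: noetherian_socle_bassian nilJ _.
apply: noetherian_in_submod_of noethM => x Jx a Ja.
exact: (congr1 val (Jx a Ja)).
Qed.
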